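(* Let $0\le a<b<\infty$ and let $f:[a,b]\rightarrow\mathbb{R}$ be continuous on $[a,b]$ with $f\in L([a,b])$. Let $l>1$ be a real number and let $p,q>0$ be fixed real numbers. If $|f|^{l}$ is $P$-convex on $[a,b]$, then $$\int_a^b (x-a)^p(b-x)^q f(x)\,dx\le (b-a)^{p+q+1}\,\beta(p+1,q+1)\left(|f(a)|^{l}+|f(b)|^{l}\right)^{\frac1l}.$$
   Context: Let $I\subseteq\mathbb{R}$ be an interval. A function $g:I\rightarrow\mathbb{R}$ is called $P$-convex on $I$ if it is nonnegative and $g(tx+(1-t)y)\le g(x)+g(y)$ for all $x,y\in I$ and all $t\in[0,1]$. $L([a,b])$ denotes the space of Lebesgue integrable functions on $[a,b]$. $\beta$ is the Euler Beta function, $\beta(x,y)=\int_0^1 t^{x-1}(1-t)^{y-1}\,dt$ for $x,y>0$. *)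

(* Defs.v *)
From HB Require Import structures.
From mathcomp Require Import all_boot all_order all_algebra.
From mathcomp Require Import all_classical all_reals all_analysis.

Set Implicit Arguments.
Unset Strict Implicit.
Unset Printing Implicit Defensive.

Import Order.TTheory GRing.Theory Num.Theory.
Import numFieldNormedType.Exports.
Local Open Scope classical_set_scope.
Local Open Scope ring_scope.

Definition P_convex (R : realType) (I : interval R) (g : R -> R) : Prop :=
  (forall x, x \in I -> 0 <= g x) /\
  (forall x y t, x \in I -> y \in I -> 0 <= t <= 1 ->
     g (t * x + (1 - t) * y) <= g x + g y).

(* The library's [beta_fun] only takes natural number arguments; this is the
   Beta function for real arguments, meaningful for 0 < x and 0 < y (where the
   integral converges). *)
Definition euler_beta (R : realType) (x y : R) : R :=
  \int[@lebesgue_measure R]_(t in `[0, 1]) (t `^ (x - 1) * (1 - t) `^ (y - 1)).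

(* Main.v *)
(** Every [x] in [[a, b]] is a convex combination of [a] and [b], so
    [P]-convexity gives [|f x|^l <= |f a|^l + |f b|^l]; taking [l]-th roots
    bounds [f] by a constant.  It remains to integrate the weight
    [(x - a)^p (b - x)^q], which the substitution [x = a + (b - a) t] turns into
    [(b - a)^(p + q + 1)] times the Beta integral. *)

Require Import Defs.
From HB Require Import structures.
From mathcomp Require Import all_boot all_order all_algebra.
From mathcomp Require Import all_classical all_reals all_analysis.
From mathcomp Require Import ring.

Import Order.TTheory GRing.Theory Num.Theory.
Import numFieldNormedType.Exports.
Local Open Scope classical_set_scope.
Local Open Scope ring_scope.

(* The absolute value is needed: [x `^ p] is [1] for [x < 0], hence
   discontinuous at [0]. *)
Lemma continuous_norm_powR (R : realType) (p : R) (p_gt0 : 0 < p) :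
  continuous (fun x : R => `|x| `^ p).
Proof.
move=> x; have [->|x_neq0] := eqVneq x 0.
  rewrite /continuous_at normr0 powR0 ?gt_eqF//.
  apply/cvgrPdist_lt => e e_gt0.
  (* The radius [e]^ p^-1[is chosen so that raising]|y| < e [^ p^-1] to the power [p] gives exactly
     the bound [e]. *)
  have d_gt0 : 0 < e `^ p^-1 by exact: powR_gt0.
  near=> y.
  rewrite sub0r normrN ger0_norm ?powR_ge0//.
  have -> : e = (e `^ p^-1) `^ p.
    by rewrite -powRrM mulVf ?gt_eqF// powRr1// ltW.
  apply: gt0_ltr_powR; rewrite ?nnegrE ?normr_ge0 ?powR_ge0//.
(* Away from 0, [|x|] is positive, and there the power function is differentiable. *)
apply: (@continuous_comp R R R (fun y : R => `|y|) (fun y : R => y `^ p)).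
  exact: norm_continuous.
apply: differentiable_continuous; apply/derivable1_diffP.
by apply: derivable_powR; rewrite in_itv/= andbT normr_gt0.
Unshelve. all: by end_near. Qed.

Lemma Rintegral_affine (R : realType) (a b : R) (G : R -> R) :
  a < b -> {within `[a, b], continuous G} ->
  \int[@lebesgue_measure R]_(x in `[a, b]) G x =
  \int[@lebesgue_measure R]_(t in `[0, 1]) (G (a + (b - a) * t) * (b - a)).
Proof.
move=> ab cG; pose F t : R := a + (b - a) * t.
have dF (t : R) : is_derive t (1 : R) F (b - a).
  rewrite /F; apply: is_derive_eq.
  by rewrite add0r mul1r /GRing.scale/= mulr1.
have F'E : derive1 F = cst (b - a).
  by apply/funext => t; rewrite derive1E derive_val.
have cF : continuous F.
  by move=> t; apply: differentiable_continuous; apply/derivable1_diffP.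
have F0 : F 0 = a by rewrite /F mulr0 addr0.
have F1 : F 1 = b by rewrite /F mulr1 addrC subrK.
(* Only the integration bounds are rewritten as [F 0] and [F 1], which puts the integral in the form
   required for substitution along the increasing map [F]. *)
rewrite /Rintegral -{1}F0 -{1}F1 integration_by_substitution_increasing//.
- by congr fine; apply: eq_integral => t _; rewrite !fctE F'E.
- by move=> s t _ _ st; rewrite /F ltrD2l ltr_pM2l// subr_gt0.
- by rewrite F'E => t _; exact: cvg_cst.
- by rewrite F'E; exact: is_cvg_cst.
- by rewrite F'E; exact: is_cvg_cst.
- split=> [t _ //||].
  + exact/cvg_at_right_filter/cF.
  + exact/cvg_at_left_filter/cF.
- by rewrite F0 F1.
Qed.

(** On the segment both bases are nonnegative, so the weight agrees there with its variant using
    absolute values, which is continuous on the whole line. *)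
Lemma continuous_beta_weight (R : realType) (a b p q : R) :
  0 < p -> 0 < q ->
  {within `[a, b], continuous (fun x => (x - a) `^ p * (b - x) `^ q)}.
Proof.
move=> p0 q0.
apply: (@subspace_eq_continuous _ _ _
  (fun x => `|x - a| `^ p * `|b - x| `^ q)).
  move=> x; rewrite inE/= in_itv/= => /andP[ax xb].
  by rewrite !ger0_norm ?subr_ge0.
apply: continuous_subspaceT => x; apply: cvgM.
- apply: (@continuous_comp R R R (fun x => x - a) (fun x => `|x| `^ p)).
    by apply: continuousB; [exact: cvg_id|exact: cvg_cst].
  exact: continuous_norm_powR.
- apply: (@continuous_comp R R R (fun x => b - x) (fun x => `|x| `^ q)).
    by apply: continuousB; [exact: cvg_cst|exact: cvg_id].
  exact: continuous_norm_powR.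
Qed.

Lemma Rintegral_beta_weight (R : realType) (a b p q : R) :
  a < b -> 0 < p -> 0 < q ->
  \int[@lebesgue_measure R]_(x in `[a, b]) ((x - a) `^ p * (b - x) `^ q) =
  (b - a) `^ (p + q + 1) * euler_beta (p + 1) (q + 1).
Proof.
move=> ab p0 q0; have ba0 : 0 < b - a by rewrite subr_gt0.
rewrite Rintegral_affine//; last exact: continuous_beta_weight.
rewrite /euler_beta !addrK -RintegralZl//; last first.
  apply: continuous_compact_integrable; first exact: segment_compact.
  (* Pulling the constant out requires the Beta integrand to be integrable. It is the weight of the
     segment from 0 to 1, once [t] is read as [t - 0]. *)
  apply: (@subspace_eq_continuous _ _ _
    (fun t => (t - 0) `^ p * (1 - t) `^ q)).
    by move=> t _; rewrite subr0.
  exact: continuous_beta_weight.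
apply: eq_Rintegral => t; rewrite inE/= in_itv/= => /andP[t0 t1].
have -> : a + (b - a) * t - a = (b - a) * t by ring.
have -> : b - (a + (b - a) * t) = (b - a) * (1 - t) by ring.
rewrite !powRM ?subr_ge0 ?(ltW ba0) ?(ltW ab)//.
(* Splitting [p + q + 1] is legitimate because the base [b - a] is nonzero; the summand 1 accounts
   for the Jacobian. *)
rewrite !powRD ?(gt_eqF ba0) ?implybT// powRr1 ?(ltW ba0)//.
ring.
Qed.

Lemma P_convex_le_endpoints (R : realType) (a b : R) (g : R -> R) (x : R) :
  a < b -> P_convex `[a, b] g -> x \in `[a, b] -> g x <= g a + g b.
Proof.
move=> ab [_ gP]; rewrite in_itv/= => /andP[ax xb].
have ba0 : 0 < b - a by rewrite subr_gt0.
(* This coefficient is the solution [t] of [t * a + (1 - t) * b = x]. *)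
have := gP a b ((b - x) / (b - a)); rewrite !in_itv/= !lexx (ltW ab)/=.
have -> : (b - x) / (b - a) * a + (1 - (b - x) / (b - a)) * b = x.
  by field; rewrite gt_eqF.
apply=> //; rewrite divr_ge0 ?subr_ge0 ?(ltW ab)//=.
by rewrite ler_pdivrMr// mul1r lerD2l lerN2.
Qed.

Theorem theorem2p3 (R : realType) (a b : R) (f : R -> R) (l p q : R)
  (a_ge0 : 0 <= a) (ltab : a < b)
  (f_cont : {within `[a, b], continuous f})
  (f_int : (@lebesgue_measure R).-integrable `[a, b] (EFin \o f))
  (l_gt1 : 1 < l) (p_gt0 : 0 < p) (q_gt0 : 0 < q)
  (f_Pconvex : P_convex `[a, b] (fun x => `|f x| `^ l)) :
  \int[@lebesgue_measure R]_(x in `[a, b])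
      ((x - a) `^ p * (b - x) `^ q * f x)
    <= (b - a) `^ (p + q + 1) * euler_beta (p + 1) (q + 1)
       * (`|f a| `^ l + `|f b| `^ l) `^ (1 / l).
Proof.
have l_gt0 : 0 < l by exact: lt_trans l_gt1.
have cw := @continuous_beta_weight R a b p q p_gt0 q_gt0.
have iw : (@lebesgue_measure R).-integrable `[a, b]
    (EFin \o (fun x => (x - a) `^ p * (b - x) `^ q)).
  by apply: continuous_compact_integrable => //; exact: segment_compact.
(* The right-hand side becomes the integral of the weight times a constant, so a pointwise
   comparison of integrands suffices. *)
rewrite -Rintegral_beta_weight// -RintegralZr//.
apply: le_Rintegral => //.
- apply: continuous_compact_integrable; first exact: segment_compact.
  by move=> x; apply: cvgM; [exact: cw|exact: f_cont].
- under [X in integrable _ _ X]eq_fun do rewrite /= EFinM.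
  exact: integrableZr.
move=> x xab; apply: ler_wpM2l; first by rewrite mulr_ge0// powR_ge0.
apply: (le_trans (ler_norm _)).
have -> : `|f x| = (`|f x| `^ l) `^ (1 / l).
  by rewrite -powRrM mul1r mulfV ?gt_eqF// powRr1.
apply: ge0_ler_powR; rewrite ?nnegrE ?addr_ge0 ?powR_ge0//.
  by rewrite divr_ge0// ltW.
exact: (P_convex_le_endpoints _ _ _ _ _ ltab f_Pconvex).
Qed.
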